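(* Let $a\le -1$ be an integer. Define $b_{\mathcal{G}}(n)$, $n\ge0$, by $b_{\mathcal{G}}(0)=1$, $b_{\mathcal{G}}(1)=-1$, $b_{\mathcal{G}}(2)=a$ and, for $n\ge3$, $$b_{\mathcal{G}}(n)=-\frac12\left(\sum_{k=0}^{n-2}b_{\mathcal{G}}(k)\binom{n}{k+1}+\sum_{k=0}^{n-1}b_{\mathcal{G}}(k)\binom{n+1}{k+1}\right).$$ For integers $0\le j\le d$ set $s_{\mathcal{G}}(j,d)=\sum_{k=j}^d\frac{1}{k+1}\binom{d-j}{d-k}b_{\mathcal{G}}(k)$. Then for all $m\ge1$: $$0\le s_{\mathcal{G}}(0,4m)\le s_{\mathcal{G}}(1,4m)\le\cdots\le s_{\mathcal{G}}(2m,4m),$$ $$0\le s_{\mathcal{G}}(2m,4m+1)\le s_{\mathcal{G}}(2m-1,4m+1)\le\cdots\le s_{\mathcal{G}}(0,4m+1),$$ $$0\ge s_{\mathcal{G}}(0,4m+2)\ge s_{\mathcal{G}}(1,4m+2)\ge\cdots\ge s_{\mathcal{G}}(2m+1,4m+2),$$ $$0\ge s_{\mathcal{G}}(2m+1,4m+3)\ge s_{\mathcal{G}}(2m,4m+3)\ge\cdots\ge s_{\mathcal{G}}(0,4m+3).$$ *)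

(* Defs.v *)
From mathcomp Require Import all_boot all_order all_algebra.
Set Implicit Arguments.
Unset Strict Implicit.
Unset Printing Implicit Defensive.
Import GRing.Theory.
Local Open Scope ring_scope.

(* The value at n computed from the sequence [:: b 0; ...; b n.-1] of the
   preceding values; since the sums run over k < n only, this is a course-of-
   values recursion. Lemmas bG0, bG1, bG2 and bG_rec below are the equations
   defining b. *)
Definition bG_step (a : int) (n : nat) (b : seq rat) : rat :=
  match n with
  | 0 => 1
  | 1 => -1
  | 2 => a%:~R
  | _ => - (1 / 2%:R) *
         (\sum_(0 <= k < n.-1) b`_k * 'C(n, k.+1)%:R
          + \sum_(0 <= k < n) b`_k * 'C(n.+1, k.+1)%:R)
  end.

Fixpoint bG_seq (a : int) (n : nat) : seq rat :=
  if n is n'.+1 then rcons (bG_seq a n') (bG_step a n' (bG_seq a n'))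
  else [::].

Definition bG (a : int) (n : nat) : rat := bG_step a n (bG_seq a n).

Definition sG (a : int) (j d : nat) : rat :=
  \sum_(j <= k < d.+1) 1 / k.+1%:R * 'C(d - j, d - k)%:R * bG a k.

Lemma size_bG_seq a n : size (bG_seq a n) = n.
Proof. by elim: n => //= n IHn; rewrite size_rcons IHn. Qed.

Lemma nth_bG_seq a n k : (k < n)%N -> (bG_seq a n)`_k = bG a k.
Proof.
elim: n => //= n IHn; rewrite ltnS leq_eqVlt nth_rcons size_bG_seq.
by case/predU1P=> [->|lt_kn]; [rewrite ltnn eqxx | rewrite lt_kn IHn].
Qed.

Lemma bG0 a : bG a 0 = 1. Proof. by []. Qed.

Lemma bG1 a : bG a 1 = -1. Proof. by []. Qed.

Lemma bG2 a : bG a 2 = a%:~R. Proof. by []. Qed.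

Lemma bG_rec a n : (3 <= n)%N ->
  bG a n = - (1 / 2%:R) *
    (\sum_(0 <= k < n.-1) bG a k * 'C(n, k.+1)%:R
     + \sum_(0 <= k < n) bG a k * 'C(n.+1, k.+1)%:R).
Proof.
case: n => [|[|[|n]]] // _; rewrite {1}/bG /bG_step; congr (_ * (_ + _)).
  apply: eq_big_nat => k /andP[_ ltk].
  by rewrite nth_bG_seq // (ltn_trans ltk).
by apply: eq_big_nat => k /andP[_ ltk]; rewrite nth_bG_seq.
Qed.

(* Main.v *)
Require Import Defs.
From HB Require Import structures.
From mathcomp Require Import all_boot all_order all_algebra.
From mathcomp Require Import boolp.
From mathcomp Require Import ring lra zify.
Set Implicit Arguments.
Unset Strict Implicit.
Unset Printing Implicit Defensive.
Import Order.TTheory GRing.Theory Num.Theory.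
Local Open Scope ring_scope.

(** Put [s(j, d) = L(x^j (1 + x)^(d - j))] for the linear functional with
    [L(x^k) = b(k) / (k + 1)]; then [s(j, d + 1) = s(j + 1, d + 1) + s(j, d)].
    The recurrence says that [C(t) = sum b(k) t^(k+1) / (k+1)!] solves
    [(1 + e^t) C' + (2 e^t - 1) C = 2 + (a + 1) t^2]. Hence [E = (1 + e^t) C]
    solves [E' + tanh(t/2) E = 2 + (a + 1) t^2] and [2 C = (1 - tanh(t/2)) E].
    As [tanh(t/2)] is odd with alternating coefficients and [a + 1 <= 0], the
    series [E] is also odd with alternating coefficients, which yields both
    [(-1)^m b(2m) >= 0], the sign of [s(0, 2m)], and [C(-t) = - e^t C(t)], that
    is, [s(j, d) = (-1)^d s(d - j, d)]. The symmetry gives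
    [2 s(m, 2m + 1) = s(m, 2m)], so the signs propagate from row to row by the
    Pascal relation, and the monotonicity of each row is the sign of the
    previous one.

    Exponential generating functions are handled as Hurwitz series: sequences
    [f] standing for [sum f(n) t^n / n!], so that the derivative is the shift. *)

(** * The commutative ring of Hurwitz series *)

Definition hurwitz (R : Type) := nat -> R.

HB.instance Definition _ (R : Type) := gen_eqMixin (hurwitz R).
HB.instance Definition _ (R : Type) := gen_choiceMixin (hurwitz R).

Lemma hurwitzP (R : Type) (f g : hurwitz R) : (forall n, f n = g n) -> f = g.
Proof. by move=> fg; apply: functional_extensionality_dep. Qed.

Section HurwitzRing.
Variable R : comNzRingType.
Implicit Types f g h : hurwitz R.

Definition hderiv f : hurwitz R := fun n => f n.+1.
Definition hadd f g : hurwitz R := fun n => f n + g n.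
Definition hopp f : hurwitz R := fun n => - f n.
Definition hconst (c : R) : hurwitz R := fun n => if n is 0 then c else 0.

(* The Leibniz rule, taken as the definition: the ring axioms then follow by
   induction on [n], without binomial identities. *)
Fixpoint hmul_rec n f g : R :=
  if n is n'.+1 then hmul_rec n' (hderiv f) g + hmul_rec n' f (hderiv g)
  else f 0%N * g 0%N.
Definition hmul f g : hurwitz R := fun n => hmul_rec n f g.

Fact haddA : associative hadd.
Proof. by move=> f g h; apply: hurwitzP => n; apply: addrA. Qed.
Fact haddC : commutative hadd.
Proof. by move=> f g; apply: hurwitzP => n; apply: addrC. Qed.
Fact hadd0 : left_id (hconst 0) hadd.
Proof. by move=> f; apply: hurwitzP => -[|n]; apply: add0r. Qed.
Fact haddN : left_inverse (hconst 0) hopp hadd.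
Proof. by move=> f; apply: hurwitzP => -[|n]; apply: addNr. Qed.

HB.instance Definition _ :=
  GRing.isZmodule.Build (hurwitz R) haddA haddC hadd0 haddN.

Lemma hmul_deriv f g :
  hderiv (hmul f g) = hadd (hmul (hderiv f) g) (hmul f (hderiv g)).
Proof. by []. Qed.

Fact hmulC : commutative hmul.
Proof.
move=> f g; apply: hurwitzP => n; rewrite /hmul.
elim: n f g => [|n IHn] f g /=; first exact: mulrC.
by rewrite addrC IHn (IHn (hderiv f)).
Qed.

Fact hmulDl : left_distributive hmul hadd.
Proof.
move=> f g h; apply: hurwitzP => n; rewrite /hmul /hadd.
elim: n f g h => [|n IHn] f g h /=; first exact: mulrDl.
by rewrite -[hderiv _]/(fun n => hderiv f n + hderiv g n) !IHn addrACA.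
Qed.

Fact hmulA : associative hmul.
Proof.
have hmulDr f g h : hmul f (hadd g h) = hadd (hmul f g) (hmul f h).
  by rewrite hmulC hmulDl !(hmulC f).
move=> f g h; apply: hurwitzP => n.
elim: n f g h => [|n IHn] f g h; first exact: mulrA.
change (hderiv (hmul f (hmul g h)) n = hderiv (hmul (hmul f g) h) n).
by rewrite !hmul_deriv hmulDr hmulDl /hadd !IHn addrA.
Qed.

Fact hmul1 : left_id (hconst 1) hmul.
Proof.
have hmul0 g n : hmul (hconst 0) g n = 0.
  have z : hmul (hconst 0) g + hmul (hconst 0) g = hmul (hconst 0) g.
    by rewrite -[LHS]hmulDl hadd0.
  move/(congr1 (fun f : hurwitz R => f n)): z => /eqP.
  by rewrite -subr_eq0 addrK => /eqP.
move=> f; apply: hurwitzP => n.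
elim: n f => [|n IHn] f; first exact: mul1r.
have d1 : hderiv (hconst 1) = hconst 0 by apply: hurwitzP => -[].
change (hderiv (hmul (hconst 1) f) n = hderiv f n).
by rewrite hmul_deriv d1 /hadd IHn hmul0 add0r.
Qed.

Fact hconst1_neq0 : hconst 1 != 0 :> hurwitz R.
Proof.
apply/eqP => /(congr1 (fun f : hurwitz R => f 0%N)) /eqP.
by rewrite /= oner_eq0.
Qed.

HB.instance Definition _ :=
  GRing.Zmodule_isComNzRing.Build (hurwitz R)
    hmulA hmulC hmul1 hmulDl hconst1_neq0.

Lemma coefhD f g n : (f + g) n = f n + g n. Proof. by []. Qed.
Lemma coefhN f n : (- f) n = - f n. Proof. by []. Qed.
Lemma coefh1 n : (1 : hurwitz R) n = (n == 0%N)%:R. Proof. by case: n. Qed.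
Lemma coefh0 n : (0 : hurwitz R) n = 0. Proof. by case: n. Qed.
Lemma coefhMS f g n : (f * g) n.+1 = (hderiv f * g) n + (f * hderiv g) n.
Proof. by []. Qed.

Lemma hderivD f g : hderiv (f + g) = hderiv f + hderiv g. Proof. by []. Qed.
Lemma hderivN f : hderiv (- f) = - hderiv f. Proof. by []. Qed.
Lemma hderivM f g : hderiv (f * g) = hderiv f * g + f * hderiv g.
Proof. by []. Qed.
Lemma hderiv1 : hderiv 1 = 0. Proof. by apply: hurwitzP => -[]. Qed.


(** * Exponential, reflection and flow of a polynomial vector field *)

Definition hexp : hurwitz R := fun=> 1.

Lemma hderiv_exp : hderiv hexp = hexp. Proof. by []. Qed.

Lemma coefh_expM f n : (hexp * f) n = \sum_(k < n.+1) 'C(n, k)%:R * f k.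
Proof.
elim: n f => [|n IHn] f; first by rewrite big_ord1 bin0.
rewrite coefhMS hderiv_exp !IHn [RHS]big_ord_recl /= /bump /=.
under [in RHS]eq_bigr => k _ do rewrite add1n binS natrD mulrDl.
rewrite big_split /= addrA; congr (_ + _).
rewrite [in RHS]big_ord_recr /= (@bin_small n n.+1) // mul0r addr0.
by rewrite big_ord_recl !bin0.
Qed.

(* [f(-t)] *)
Definition hreflect f : hurwitz R := fun n => (-1) ^+ n * f n.

Lemma hderiv_reflect f : hderiv (hreflect f) = - hreflect (hderiv f).
Proof.
apply: hurwitzP => n.
by rewrite coefhN /hderiv /hreflect exprS mulN1r mulNr.
Qed.

Lemma hreflectD f g : hreflect (f + g) = hreflect f + hreflect g.
Proof. by apply: hurwitzP => n; apply: mulrDr. Qed.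

Lemma hreflectN f : hreflect (- f) = - hreflect f.
Proof. by apply: hurwitzP => n; apply: mulrN. Qed.

Lemma hreflect1 : hreflect 1 = 1.
Proof. by apply: hurwitzP => -[|n]; rewrite /hreflect ?mulr1 ?mulr0. Qed.

Lemma hreflectM f g : hreflect (f * g) = hreflect f * hreflect g.
Proof.
apply: hurwitzP => n; elim: n f g => [|n IHn] f g.
  by rewrite -[RHS]/(1 * f 0%N * (1 * g 0%N)) !mul1r -[LHS]/(1 * _) mul1r.
change (hderiv (hreflect (f * g)) n = hderiv (hreflect f * hreflect g) n).
rewrite hderiv_reflect !hderivM !hderiv_reflect hreflectD.
by rewrite mulNr mulrN !(coefhD, coefhN) !IHn opprD.
Qed.

Lemma coefhM_eq0 f g n : (forall k, (k <= n)%N -> g k = 0) -> (f * g) n = 0.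
Proof.
elim: n f g => [|n IHn] f g g0.
  by rewrite -[LHS]/(f 0%N * g 0%N) g0 ?mulr0.
by rewrite coefhMS !IHn ?addr0 // => k lekn; apply: g0; lia.
Qed.

(* The [n]-th derivative of [q(y)] at time [0], where [y] is the solution of
   [y' = v(y)], [y(0) = c]. *)
Definition hflow (v : {poly R}) (c : R) (q : {poly R}) : hurwitz R :=
  fun n => (iter n (fun p : {poly R} => p^`() * v) q).[c].

Lemma hderiv_flow v c q : hderiv (hflow v c q) = hflow v c (q^`() * v).
Proof. by apply: hurwitzP => n; rewrite /hderiv /hflow iterSr. Qed.

Lemma hflowD v c p q : hflow v c (p + q) = hflow v c p + hflow v c q.
Proof.
apply: hurwitzP => n; rewrite coefhD /hflow -hornerD; congr _.[_].
by elim: n => //= n ->; rewrite derivD mulrDl.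
Qed.

Lemma hflowM v c p q : hflow v c (p * q) = hflow v c p * hflow v c q.
Proof.
apply: hurwitzP => n; elim: n p q => [|n IHn] p q; first exact: hornerM.
rewrite coefhMS !hderiv_flow -!IHn -coefhD -hflowD.
rewrite -[LHS]/(hderiv (hflow v c (p * q)) n) hderiv_flow derivM.
by congr (hflow _ _ _ _); ring.
Qed.

Lemma hflow1 v c : hflow v c 1 = 1.
Proof.
have Z n : iter n (fun p : {poly R} => p^`() * v) 0 = 0.
  by elim: n => //= n ->; rewrite deriv0 mul0r.
apply: hurwitzP => -[|n]; first by rewrite /hflow /= hornerE.
by rewrite /hflow iterSr derivC mul0r Z hornerE.
Qed.

End HurwitzRing.

Arguments hexp {R}.

(** * The series tanh(t/2) and alternating sign patterns *)

Section RationalSeries.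
Implicit Types f g w : hurwitz rat.

Lemma linear_ode_eq0 g w : hderiv w + hderiv w = g * w -> w 0%N = 0 -> w = 0.
Proof.
move=> ode w0; apply: hurwitzP => n; rewrite coefh0.
elim/ltn_ind: n => -[//|n] IHn.
have /eqP : (hderiv w + hderiv w) n = 0.
  by rewrite ode; apply: coefhM_eq0 => k lekn; apply: IHn.
by rewrite coefhD -mulr2n mulrn_eq0 => /eqP.
Qed.

(* [tanh(t/2)], the solution of [y' = (1 - y^2) / 2], [y(0) = 0] *)
Definition htanh : hurwitz rat := hflow (2^-1%:P * (1 - 'X ^+ 2)) 0 'X.

Lemma htanh0 : htanh 0%N = 0.
Proof. by rewrite /htanh /hflow /= hornerE. Qed.

Lemma hderiv_tanh : hderiv htanh + hderiv htanh = 1 - htanh ^+ 2.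
Proof.
apply/eqP; rewrite eq_sym subr_eq eq_sym; apply/eqP.
rewrite (expr2 htanh) /htanh hderiv_flow -hflowM -!hflowD.
rewrite -[RHS](hflow1 (2^-1%:P * (1 - 'X ^+ 2)) 0).
congr hflow; rewrite derivX mul1r -mulrDl -polyCD.
have -> : 2^-1 + 2^-1 = 1 :> rat by [].
by rewrite mul1r -expr2 subrK.
Qed.

(** With T = [htanh], the difference W of the two sides satisfies 2 W' = (1 - T) W and W(0) = 0. *)
Lemma hexp_tanh : hexp * (1 - htanh) = 1 + htanh.
Proof.
apply/eqP; rewrite -subr_eq0; apply/eqP.
apply: (@linear_ode_eq0 (1 - htanh)).
  rewrite !(hderivD, hderivN, hderivM, hderiv1) hderiv_exp.
  transitivity (hexp * (1 - htanh) *+ 2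
                - (hexp + 1) * (hderiv htanh + hderiv htanh)); first by ring.
  by rewrite hderiv_tanh; ring.
rewrite coefhD coefhN /= -[(hexp * _) 0%N]/(1 * (1 - htanh 0%N)).
by rewrite coefhD htanh0.
Qed.

(* The sign pattern of the derivatives of [cos] at [0], shifted by [s]. *)
Definition alternates s f n : bool :=
  if odd (n + s) then f n == 0 else 0 <= (-1) ^+ (n + s)./2 * f n.

Lemma alternates_deriv s f n :
  alternates s.+1 (hderiv f) n = alternates s f n.+1.
Proof. by rewrite /alternates addnS. Qed.

Lemma alternates_half s f n : alternates s (f + f) n = alternates s f n.
Proof.
rewrite /alternates coefhD -mulr2n; case: ifP => _; first by rewrite mulrn_eq0.
by rewrite mulrnAr pmulrn_lge0.
Qed.

Lemma alternatesD s f g n :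
  alternates s f n -> alternates s g n -> alternates s (f + g) n.
Proof.
rewrite /alternates coefhD; case: ifP => _; first by move=> /eqP-> /eqP->.
by rewrite mulrDr; apply: addr_ge0.
Qed.

Lemma alternatesN s f n : alternates s (- f) n = alternates s.+2 f n.
Proof.
rewrite /alternates !addnS /= negbK coefhN oppr_eq0; case: ifP => // _.
by rewrite exprS mulN1r mulrN mulNr.
Qed.

(** The induction varies [s] and [t], because differentiating one factor raises its shift by one. *)
Lemma alternatesM s t f g n :
  (forall k, (k <= n)%N -> alternates s f k) ->
  (forall k, (k <= n)%N -> alternates t g k) ->
  alternates (s + t) (f * g) n.
Proof.
elim: n s t f g => [|n IHn] s t f g altf altg; last first.
  rewrite -alternates_deriv hderivM; apply: alternatesD.
    rewrite -addSn; apply: IHn => k lekn; last by apply: altg; lia.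
    by rewrite alternates_deriv altf.
  rewrite -addnS; apply: IHn => k lekn; first by apply: altf; lia.
  by rewrite alternates_deriv altg.
move: (altf 0%N isT) (altg 0%N isT); rewrite /alternates !add0n.
rewrite -[(f * g) 0%N]/(f 0%N * g 0%N) oddD.
case: ifP => [_ /eqP-> _|es]; first by rewrite !mul0r mulr0 lexx eqxx if_same.
case: (odd t) => f0 g0; first by rewrite (eqP g0) mulr0 eqxx.
by rewrite /= halfD es /= add0n exprD mulrACA mulr_ge0.
Qed.

(** Shift 3 is the pattern of sine. By induction T^2 has shift 6, so - T^2 has shift 4, the one
    required of 2 T' = 1 - T^2. *)
Lemma alternates_tanh n : alternates 3 htanh n.
Proof.
elim/ltn_ind: n => -[|n] IHn; first by rewrite /alternates /= htanh0.
rewrite -alternates_deriv -alternates_half hderiv_tanh.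
have -> : 1 - htanh ^+ 2 = 1 - (htanh * htanh) by rewrite expr2.
apply: alternatesD.
  rewrite /alternates coefh1; case: n {IHn} => [|n] //=.
  by rewrite mulr0 eqxx if_same.
by rewrite alternatesN; apply: (@alternatesM 3 3) => k lekn; apply: IHn.
Qed.

(* The feedback term [- htanh * f] has the same sign pattern as [g]. *)
Lemma alternates_tanh_ode f g :
  f 0%N = 0 -> hderiv f = g - htanh * f -> (forall n, alternates 4 g n) ->
  forall n, alternates 3 f n.
Proof.
move=> f0 ode altg n.
elim/ltn_ind: n => -[|n] IHn; first by rewrite /alternates /= f0.
rewrite -alternates_deriv ode; apply: alternatesD => //; rewrite alternatesN.
by apply: (@alternatesM 3 3) => k lekn; [apply: alternates_tanh | apply: IHn].
Qed.

Lemma alternates3_odd f : (forall n, alternates 3 f n) -> hreflect f = - f.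
Proof.
move=> altf; apply: hurwitzP => n; rewrite coefhN /hreflect.
move: (altf n); rewrite /alternates oddD addbT.
case: (boolP (odd n)) => [on _|_ /eqP->].
  by rewrite -signr_odd on mulN1r.
by rewrite mulr0 oppr0.
Qed.

End RationalSeries.

(** * The differential equation for the sequence b *)

Section Sequence.
Variable a : int.

(* Its exponential generating function is the integral of that of [bG a]. *)
Definition bGint : hurwitz rat := fun n => if n is k.+1 then bG a k else 0.

Definition bGsource : hurwitz rat :=
  fun n => match n with 0 => 2 | 2 => 2 * (a%:~R + 1) | _ => 0 end.

Lemma coef_exp_bGint n :
  (hexp * bGint) n = \sum_(0 <= k < n) bG a k * 'C(n, k.+1)%:R.
Proof.
rewrite coefh_expM big_ord_recl mulr0 add0r big_mkord.
by apply: eq_bigr => k _; rewrite mulrC.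
Qed.

Lemma bGint_ode :
  hderiv bGint * (1 + hexp) + bGint * (hexp + hexp - 1) = bGsource.
Proof.
apply: hurwitzP => n.
(* In this form the coefficients of e^t C at n and n + 1 are the two sums of the recurrence, each
   with one extra top term. *)
have -> : hderiv bGint * (1 + hexp) + bGint * (hexp + hexp - 1)
   = hderiv bGint - bGint + hexp * bGint + hderiv (hexp * bGint).
  by rewrite hderivM hderiv_exp; ring.
rewrite !coefhD coefhN [in LHS]/hderiv !coef_exp_bGint.
case: n => [|[|[|n]]].
- by rewrite big_nat1 big_geq.
- by rewrite big_nat1 !big_nat_recr //= big_geq.
- rewrite !big_nat_recr //= !big_geq //= !add0r.
  by rewrite !binn bin1; ring.
rewrite -[bGint n.+4]/(bG a n.+3) -[bGint n.+3]/(bG a n.+2) -[RHS]/(0 : rat).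
have sum_recr (F : nat -> rat) m :
    \sum_(0 <= k < m.+1) F k = \sum_(0 <= k < m) F k + F m.
  by rewrite big_nat_recr.
(* The extra top terms have binomial coefficient 1: one cancels - b(n - 1), the other doubles
   b(n). *)
rewrite sum_recr [X in _ + X = _]sum_recr !binn.
have := @bG_rec a n.+3 isT; rewrite -[n.+3.-1]/(n.+2); lra.
Qed.

Definition bGodd : hurwitz rat := bGint * (1 + hexp).

(** By [hexp_tanh], (1 + e^t) (1 - T) = 2. *)
Lemma bGodd_tanh : bGint + bGint = bGodd * (1 - htanh).
Proof. by rewrite /bGodd -mulrA mulrDl mul1r hexp_tanh; ring. Qed.

Lemma bGodd_ode : hderiv bGodd = bGsource - htanh * bGodd.
Proof.
rewrite -bGint_ode /bGodd hderivM hderivD hderiv1 hderiv_exp.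
have et : htanh * hexp = hexp - 1 - htanh.
  by rewrite -addrA -opprD -hexp_tanh; ring.
by ring: et.
Qed.

(** * The numbers s(j, d) as values of the functional L *)

Definition bGmoment : hurwitz rat := fun k => bG a k / k.+1%:R.

(** Multiplication by [hexp] is the binomial transform, here applied to the moments of x^j L. *)
Lemma sGE j n :
  sG a j (j + n) = (hexp * (fun k => bGmoment (k + j)%N) : hurwitz rat) n.
Proof.
rewrite coefh_expM /sG -{1}[j]add0n big_addn.
have -> : ((j + n).+1 - j = n.+1)%N by lia.
rewrite big_mkord; apply: eq_bigr => k _; have ? := ltn_ord k.
have -> : (j + n - j = n)%N by lia.
have -> : (j + n - (k + j) = n - k)%N by lia.
by rewrite bin_sub // mul1r -mulrA mulrC -mulrA.
Qed.

Lemma sG_pascal j d : (j <= d)%N -> sG a j d.+1 = sG a j.+1 d.+1 + sG a j d.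
Proof.
move=> /subnKC <-; move: (d - j)%N => n.
rewrite -addnS !sGE.
rewrite coefhMS hderiv_exp addrC; congr (_ + _).
suff -> : hderiv (fun k => bGmoment (k + j)%N)
          = (fun k => bGmoment (k + j.+1)%N).
  by rewrite -addSnnS sGE.
by apply: hurwitzP => k; rewrite /hderiv addSnnS.
Qed.

Lemma sG_diff j d : (j <= d)%N -> sG a j.+1 d.+1 = sG a j d.+1 - sG a j d.
Proof. by move=> lejd; rewrite [sG a j d.+1]sG_pascal ?addrK. Qed.

Lemma sG_diag d : sG a d d = bGmoment d.
Proof. by rewrite -{2}[d]addn0 sGE -[LHS]/(1 * _) mul1r. Qed.

Hypothesis ha : a <= -1.

Lemma bGodd_alternates n : alternates 3 bGodd n.
Proof.
apply: (alternates_tanh_ode _ bGodd_ode) => [|k].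
  by rewrite -[LHS]/(0 * _) mul0r.
case: k => [|[|[|k]]] //; last first.
  by rewrite /alternates /bGsource mulr0 eqxx if_same.
(* At order 2 the sign is (-1)^3, so the claim is a + 1 <= 0. *)
rewrite /alternates /= -signr_odd /= mulN1r oppr_ge0 pmulr_rle0 //.
by rewrite -[1 in X in X <= _]/(1%:~R) -intrD -[0]/(0%:~R) ler_int; lia.
Qed.

(** In 2 C = E - E T the product E T is even, so at order 2m + 1 only E contributes to 2 b(2m). *)
Lemma bG_even_sign m : 0 <= (-1) ^+ m * bG a (2 * m).
Proof.
have altEt : alternates 6 (bGodd * htanh) (2 * m).+1.
  apply: (@alternatesM 3 3) => k _; first exact: bGodd_alternates.
  exact: alternates_tanh.
have Et0 : (bGodd * htanh) (2 * m).+1 = 0.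
  by move: altEt; rewrite /alternates !oddD /= mul2n odd_double => /eqP.
have := bGodd_alternates (2 * m).+1; rewrite /alternates.
have -> : bGodd (2 * m).+1 = (bGint + bGint) (2 * m).+1.
  by rewrite bGodd_tanh mulrBr mulr1 coefhD coefhN Et0 subr0.
have -> : odd ((2 * m).+1 + 3) = false by lia.
have -> : ((2 * m).+1 + 3)./2 = m.+2 by lia.
by rewrite coefhD -mulr2n mulrnAr pmulrn_lge0 // !exprS !mulN1r opprK.
Qed.

(** As E and T are odd, reflecting 2 C = E (1 - T) gives - E (1 + T) = - e^t E (1 - T). *)
Lemma bGint_reflect : hreflect bGint = - (hexp * bGint).
Proof.
have: hreflect (bGint + bGint) = - (hexp * (bGint + bGint)).
  rewrite bGodd_tanh hreflectM hreflectD hreflect1 hreflectN.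
  rewrite !alternates3_odd; [|exact: alternates_tanh | exact: bGodd_alternates].
  by rewrite opprK -hexp_tanh; ring.
rewrite hreflectD mulrDr opprD => E; apply: hurwitzP => n.
move/(congr1 (fun f : hurwitz rat => f n)): E; rewrite !coefhD; lra.
Qed.

(** This is the coefficient of order d + 1 in [bGint_reflect]; (d + 1) C(d, k) = (k + 1) C(d + 1, k
    + 1) absorbs the denominators. *)
Lemma sG0 d : sG a 0 d = (-1) ^+ d * bGmoment d.
Proof.
rewrite -[d in LHS]add0n sGE coefh_expM.
have /(congr1 (fun f : hurwitz rat => f d.+1)) := bGint_reflect.
rewrite coefhN coefh_expM big_ord_recl mulr0 add0r /hreflect exprS mulN1r mulNr.
move/oppr_inj => E; apply: (@mulfI _ d.+1%:R); first by rewrite pnatr_eq0.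
have momentE k : k.+1%:R * bGmoment k = bG a k.
  by rewrite mulrC divfK ?pnatr_eq0.
rewrite mulrCA momentE [RHS]E big_distrr; apply: eq_bigr => k _ /=.
rewrite addn0 mulrA -natrM mul_bin_diag natrM.
by rewrite [k.+1%:R * _]mulrC -mulrA momentE.
Qed.

Lemma sG_sym j d : (j <= d)%N -> sG a j d = (-1) ^+ d * sG a (d - j) d.
Proof.
elim: j d => [|j IHj] d; first by rewrite subn0 sG_diag sG0.
case: d => // d lejd; have ? : (j <= d)%N by lia.
rewrite sG_diff // !IHj ?leqW // subSS subSn // [in RHS]sG_pascal ?leq_subr //.
rewrite exprS; ring.
Qed.

(** * Propagation of signs from row to row *)

Lemma sG_middle m : sG a m (2 * m).+1 = sG a m (2 * m) / 2.
Proof.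
(* By symmetry the two middle entries of row 2m + 1 are opposite; by Pascal they differ by s(m,
   2m). *)
have := @sG_sym m (2 * m).+1; have -> : ((2 * m).+1 - m = m.+1)%N by lia.
have -> : (-1) ^+ (2 * m).+1 = -1 :> rat.
  by rewrite -signr_odd /= mul2n odd_double.
have := @sG_pascal m (2 * m).
have le : (m <= 2 * m)%N by lia.
move=> /(_ le) E /(_ (leqW le)); lra.
Qed.

(** Start from the middle entry and let j decrease: the Pascal relation adds terms of equal sign. *)
Lemma sG_sign_step m :
  (forall j, (j <= m)%N -> 0 <= (-1) ^+ m * sG a j (2 * m)) ->
  forall j, (j <= m)%N -> 0 <= (-1) ^+ m * sG a j (2 * m).+1.
Proof.
move=> sgn j; elim: {j}(m - j)%N {-2}j (erefl (m - j)%N) => [|n IHn] j En lejm.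
  have -> : j = m by lia.
  by rewrite sG_middle mulrA divr_ge0 // sgn.
rewrite sG_pascal; last by lia.
by rewrite mulrDr addr_ge0 ?sgn ?IHn //; lia.
Qed.

(** Start from j = 0, where the sign is that of b(2m), and let j increase: each step subtracts an
    entry of the previous odd row, of opposite sign. *)
Lemma sG_even_sign m j : (j <= m)%N -> 0 <= (-1) ^+ m * sG a j (2 * m).
Proof.
elim: m j => [|m IHm] j.
  by rewrite leqn0 => /eqP->; rewrite sG0 /bGmoment bG0.
elim: j => [_|j IHj lejm].
  rewrite sG0 -(signr_odd _ (2 * m.+1)) mul2n odd_double mul1r -mul2n.
  by rewrite /bGmoment mulrA divr_ge0 // bG_even_sign.
have E2 : (2 * m.+1 = (2 * m).+2)%N by lia.
rewrite E2 sG_diff -?E2; last by lia.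
rewrite mulrBr addr_ge0 ?IHj //; first by lia.
by rewrite exprS mulN1r mulNr opprK sG_sign_step.
Qed.

Lemma sG_odd_sign m j : (j <= m)%N -> 0 <= (-1) ^+ m * sG a j (2 * m).+1.
Proof. by apply: sG_sign_step => k; apply: sG_even_sign. Qed.

End Sequence.

Theorem mainTheorem16 (a : int) (ha : a <= -1) (m : nat) (hm : (1 <= m)%N) :
  [/\ 0 <= sG a 0 (4 * m) /\
      (forall j : nat, (j < 2 * m)%N ->
         sG a j (4 * m) <= sG a j.+1 (4 * m)),
      0 <= sG a (2 * m) (4 * m + 1) /\
      (forall j : nat, (j < 2 * m)%N ->
         sG a j.+1 (4 * m + 1) <= sG a j (4 * m + 1)),
      0 >= sG a 0 (4 * m + 2) /\
      (forall j : nat, (j < 2 * m + 1)%N ->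
         sG a j (4 * m + 2) >= sG a j.+1 (4 * m + 2))
    & 0 >= sG a (2 * m + 1) (4 * m + 3) /\
      (forall j : nat, (j < 2 * m + 1)%N ->
         sG a j.+1 (4 * m + 3) >= sG a j (4 * m + 3))].
Proof.
have se : (-1) ^+ (2 * m) = 1 :> rat by rewrite -signr_odd mul2n odd_double.
have so : (-1) ^+ (2 * m).+1 = -1 :> rat by rewrite exprS se mulr1.
have s0 j : (j <= 2 * m)%N -> 0 <= sG a j (4 * m).
  by move/(sG_even_sign ha); rewrite se mul1r mulnA.
have s1 j : (j <= 2 * m)%N -> 0 <= sG a j (4 * m).+1.
  by move/(sG_odd_sign ha); rewrite se mul1r mulnA.
have s2 j : (j <= 2 * m + 1)%N -> sG a j (4 * m).+2 <= 0.
  rewrite addn1 => /(sG_even_sign ha); rewrite so mulN1r oppr_ge0.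
  by have -> : (2 * (2 * m).+1 = (4 * m).+2)%N by lia.
have s3 j : (j <= 2 * m + 1)%N -> sG a j (4 * m).+3 <= 0.
  rewrite addn1 => /(sG_odd_sign ha); rewrite so mulN1r oppr_ge0.
  by have -> : (2 * (2 * m).+1 = (4 * m).+2)%N by lia.
rewrite addn1 addn2 addn3.
split; split=> [|j ltj]; rewrite ?s0 ?s1 ?s2 ?s3 ?leqnn //.
(* Row 4m is compared with row 4m - 1, which belongs to the previous block; [hm] allows the shift of
   [m]. *)
- case: m hm ltj {se so s0 s1 s2 s3} => // m _ ltj.
  have E : (4 * m.+1 = (2 * (2 * m).+1).+2)%N by lia.
  rewrite E sG_diff; last by lia.
  rewrite lerDl oppr_ge0.
  have /(sG_odd_sign ha) : (j <= (2 * m).+1)%N by lia.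
  by rewrite exprS -signr_odd mul2n odd_double mulr1 mulN1r oppr_ge0.
- by rewrite sG_diff; [rewrite gerDl oppr_le0 s0 // ltnW | lia].
- by rewrite sG_diff; [rewrite gerDl oppr_le0 s1 //; lia | lia].
- by rewrite sG_diff; [rewrite lerDl oppr_ge0 s2 // ltnW | lia].
Qed.
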